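(* Let $\kappa,\kappa'$ be cardinals, each equal to $1$ or at least $\aleph_0$, and let $V$ and $V'$ be topological vector spaces over the discrete field $k$ such that $V$ has the $\kappa$-codimension topology and $V'$ has the $\kappa'$-codimension topology. If $\kappa'\leqslant\kappa$, then $\mathrm{CHom}(V,V') = \mathrm{Hom}(V,V')$.
   Context: Fix a field $k$ with the discrete topology; all vector spaces are over $k$. For a cardinal $\kappa$ with $\kappa=1$ or $\kappa\geqslant\aleph_0$, the $\kappa$-codimension topology on a vector space $V$ is the vector space topology whose neighborhood filter of $0$ is generated by the set of all vector subspaces $W$ of $V$ with $\mathrm{codim}\, W=\dim V/W<\kappa$. $\mathrm{Hom}(V,V')$ is the set of all linear maps $V\to V'$, and $\mathrm{CHom}(V,V')$ the subset of continuous linear maps. *)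

(* Defs.v *)
From HB Require Import structures.
From mathcomp Require Import all_boot all_order all_algebra.
From mathcomp Require Import generic_quotient ring_quotient.
From mathcomp Require Import boolp classical_sets functions cardinality filter.
From mathcomp Require Import topology.

Set Implicit Arguments.
Unset Strict Implicit.
Unset Printing Implicit Defensive.

Import GRing.Theory.

Local Open Scope classical_set_scope.
Local Open Scope card_scope.
Local Open Scope ring_scope.
Local Open Scope quotient_scope.

(* Cardinals are represented by types, compared through [#<=] and [#=]. *)

Definition one_or_infinite (kappa : Type) : Prop :=
  [set: kappa] #= [set: unit] \/ [set: nat] #<= [set: kappa].

Section Dimension.
Variables (k : fieldType) (V : lmodType k).

Definition linearly_independent (B : set V) : Prop :=
  forall (s : seq V) (c : V -> k), uniq s -> [set` s] `<=` B ->
    \sum_(v <- s) c v *: v = 0 -> forall v, v \in s -> c v = 0.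

Definition generating (B : set V) : Prop :=
  forall x : V, exists (s : seq V) (c : V -> k),
    [set` s] `<=` B /\ x = \sum_(v <- s) c v *: v.

Definition is_basis (B : set V) : Prop :=
  linearly_independent B /\ generating B.

(* A basis exists and any two bases are equipotent, so [dim V < kappa] may be
   tested on one basis. *)
Definition dim_lt (kappa : Type) : Prop :=
  exists2 B : set V, is_basis B &
    B #<= [set: kappa] /\ ~ ([set: kappa] #<= B).

End Dimension.

(* The quotient V / W as a vector space; the additive group is the library's
   quotient. As [W : submodClosed V] is a boolean predicate, classically it is
   an arbitrary vector subspace. *)
Section QuotientSpace.
Variables (k : fieldType) (V : lmodType k) (W : submodClosed V).

Definition submod_zmodClosed : zmodClosed V :=
  HB.pack (W : {pred V})
    (GRing.isZmodClosed.Build V (W : {pred V})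
       (GRing.submod_closedB (submodClosedP W))).

Definition quotv : Type := Quotient.quot submod_zmodClosed.

HB.instance Definition _ := Choice.on quotv.
HB.instance Definition _ := EqQuotient.on quotv.
HB.instance Definition _ := GRing.Zmodule.on quotv.
HB.instance Definition _ := ZmodQuotient.on quotv.

Definition quotv_scale (a : k) (x : quotv) : quotv :=
  \pi_quotv (a *: repr x).

Lemma pi_quotv_scale (a : k) (x : V) :
  \pi_quotv (a *: x) = quotv_scale a (\pi_quotv x).
Proof.
apply/eqP; rewrite -Quotient.idealrBE -scalerBr.
have : x - repr (\pi_quotv x) \in submod_zmodClosed.
  by rewrite Quotient.idealrBE reprK.
exact: (@rpredZ _ _ W).
Qed.

Let scaleA a b x : quotv_scale a (quotv_scale b x) = quotv_scale (a * b) x.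
Proof.
rewrite -[x]reprK; move: (repr x) => y.
by rewrite -(pi_quotv_scale b) -!pi_quotv_scale scalerA.
Qed.

Let scale1 : left_id 1 quotv_scale.
Proof.
move=> x; rewrite -[x]reprK; move: (repr x) => y.
by rewrite -pi_quotv_scale scale1r.
Qed.

Let scaleDr : right_distributive quotv_scale +%R.
Proof.
move=> a x y; rewrite -[x]reprK -[y]reprK.
move: (repr x) (repr y) => u v.
by rewrite -raddfD -!pi_quotv_scale scalerDr raddfD.
Qed.

Let scaleDl x : {morph quotv_scale^~ x : a b / a + b}.
Proof.
move=> a b; rewrite -[x]reprK; move: (repr x) => y.
by rewrite -!pi_quotv_scale scalerDl raddfD.
Qed.

HB.instance Definition _ :=
  GRing.Zmodule_isLmodule.Build k quotv scaleA scale1 scaleDr scaleDl.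

End QuotientSpace.

Definition codim_lt (k : fieldType) (V : lmodType k) (W : submodClosed V)
  (kappa : Type) : Prop := dim_lt (quotv W) kappa.

(* Topological vector spaces over a discrete field, not necessarily Hausdorff.
   The [topologicalLmodType] of mathcomp-analysis requires normed scalars, and
   its hierarchy (file tvs.v) rules out a variant over arbitrary fields, hence
   the independent structure. *)
HB.mixin Record TopologicalLmodule_isDiscreteTvs (k : fieldType) V
    & Topological V & GRing.Lmodule k V := {
  dtvs_add_continuous : continuous (fun z : V * V => z.1 + z.2);
  dtvs_scale_continuous :
    continuous (fun z : discrete_topology k * V => (z.1 : k) *: z.2)
}.

#[short(type="discreteTvsType")]
HB.structure Definition DiscreteTvs (k : fieldType) :=
  {V of Topological V & GRing.Lmodule k V
        & TopologicalLmodule_isDiscreteTvs k V}.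

(* The neighborhoods of 0 determine the topology of a topological vector
   space. *)
Definition has_codim_topology (k : fieldType) (V : discreteTvsType k)
    (kappa : Type) : Prop :=
  nbhs (0 : V) =
  smallest Filter
    [set [set` W] | W in [set W : submodClosed V | codim_lt W kappa]].

Definition LHom (k : fieldType) (V V' : lmodType k) : set {linear V -> V'} :=
  setT.

Definition CHom (k : fieldType) (V V' : discreteTvsType k) :
  set {linear V -> V'} := [set f | continuous f].

Arguments LHom {k} V V'.
Arguments CHom {k} V V'.

(* Main.v *)
(* A linear map [f : V -> V'] induces an injection of [V / f^-1(W')] into
   [V' / W'], so [codim f^-1(W') <= codim W'] and preimages of basic
   neighborhoods of [0] are basic neighborhoods of [0].

   Monotonicity of the dimension along an injection [g : U -> Q]: let [B] be a
   basis of [Q] and let [A] be maximal among the subsets of [B] whose span meets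
   [g(U)] trivially. Then every [b] in [B \ A] is congruent modulo [span A] to
   some [g (e b)], and the vectors [e b] form a basis of [U]. *)
Require Import Defs.
From HB Require Import structures.
From mathcomp Require Import all_boot all_order all_algebra.
From mathcomp Require Import generic_quotient ring_quotient boolp filter.
From mathcomp Require Import classical_sets functions cardinality topology.

Import GRing.Theory.

(** * Spans and linear independence modulo a subset *)

Section Span.
Local Open Scope classical_set_scope.
Local Open Scope ring_scope.
Context {k : fieldType} {V : lmodType k}.
Implicit Types (A B : set V) (x y : V).

(** Terms may repeat a vector, so closure properties follow by adding one term at a time. *)
Inductive span A : V -> Prop :=
| span0 : span A 0
| span_cons a v x : A v -> span A x -> span A (a *: v + x).

Lemma spanD {A x y} : span A x -> span A y -> span A (x + y).
Proof.
move=> sx sy; elim: sx => [|a v z Av _ IH]; first by rewrite add0r.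
by rewrite -addrA; apply: span_cons.
Qed.

Lemma spanZ {A x} (a : k) : span A x -> span A (a *: x).
Proof.
elim=> [|b v z Av _ IH]; first by rewrite scaler0; exact: span0.
by rewrite scalerDr scalerA; apply: span_cons.
Qed.

Lemma spanN {A x} : span A x -> span A (- x).
Proof. by rewrite -scaleN1r; exact: spanZ. Qed.

Lemma span_sub {A B x} : A `<=` B -> span A x -> span B x.
Proof.
move=> AB; elim=> [|a v z Av _ IH]; first exact: span0.
by apply: span_cons => //; exact: AB.
Qed.

Lemma span_set0 {x} : span set0 x -> x = 0.
Proof. by case=> // ? ? ? []. Qed.

Lemma span_sum A (I : eqType) (s : seq I) (c : I -> k) (F : I -> V) :
  (forall i, i \in s -> span A (F i)) -> span A (\sum_(i <- s) c i *: F i).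
Proof.
move=> sF; rewrite big_seq.
by apply: big_ind => [|x y|i /sF]; [exact: span0 | exact: spanD | exact: spanZ].
Qed.

Lemma mem_span {A x} : A x -> span A x.
Proof.
by move=> Ax; rewrite -[x]addr0 -[x]scale1r; apply: span_cons => //; exact: span0.
Qed.

(** Terms with the same vector are merged by adding coefficients. This gives the duplicate-free
    lists on which [linearly_independent] is tested. *)
Lemma span_uniqP {A x} : span A x ->
  exists s (c : V -> k), [/\ uniq s, [set` s] `<=` A &
    x = \sum_(v <- s) c v *: v].
Proof.
elim=> [|a v z Av _ [s [c [us sA ->]]]].
  by exists [::], (fun=> 0); split => //; rewrite big_nil.
have [vs|vs] := boolP (v \in s).
  exists s, (fun w => c w + (if w == v then a else 0)); split => //.
  rewrite (bigD1_seq v) //= [RHS](bigD1_seq v) //= eqxx scalerDl.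
  rewrite addrA [a *: v + _]addrC; congr (_ + _).
  by apply: eq_bigr => w /negbTE ->; rewrite addr0.
exists (v :: s), (fun w => if w == v then a else c w); split => /=.
- by rewrite vs.
- by move=> w /=; rewrite inE => /predU1P[->|/sA].
rewrite big_cons eqxx; congr (_ + _); apply: eq_big_seq => w ws.
by case: eqP => // wv; rewrite -wv ws in vs.
Qed.

Lemma span_generating B : generating B <-> forall x, span B x.
Proof.
split=> [gB x|sB x]; last first.
  by have [s [c [_ sBs xE]]] := span_uniqP (sB x); exists s, c.
have [s [c [sB ->]]] := gB x.
by apply: span_sum => v vs; apply: mem_span; exact: sB.
Qed.

Lemma span_setU1 {A b x} : span (b |` A) x -> exists a, span A (x - a *: b).
Proof.
elim=> [|a v z [->|Av] _ [d sz]].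
- by exists 0; rewrite scale0r subr0; exact: span0.
- by exists (a + d); rewrite scalerDl opprD addrACA subrr add0r.
- by exists d; rewrite -addrA; exact: span_cons.
Qed.

(** A combination uses finitely many vectors, and in a chain these all lie in one member. The
    alternative [x = 0] covers the empty chain. *)
Lemma span_bigcup_total {F : set (set V)} {x} : total_on F subset ->
  span (\bigcup_(X in F) X) x -> x = 0 \/ exists2 X, F X & span X x.
Proof.
move=> tF; elim=> [|a v z [X FX Xv] _ IH]; first by left.
right; case: IH => [->|[Y FY sY]].
  by exists X => //; apply: span_cons => //; exact: span0.
have [XY|YX] := tF _ _ FX FY.
  by exists Y => //; apply: span_cons => //; exact: XY.
by exists X => //; apply: span_cons => //; exact: span_sub sY.
Qed.

(** Write the sum as a combination over a list [t] in [A]. Since [s] avoids [A], subtracting gives a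
    relation over the duplicate-free list [s ++ t] in [B], with coefficients [c] off [A] and [- d]
    on [A]. *)
Lemma linearly_independent_mod A B (s : seq V) (c : V -> k) :
    linearly_independent B -> A `<=` B -> uniq s -> [set` s] `<=` B `\` A ->
    span A (\sum_(v <- s) c v *: v) ->
  forall v, v \in s -> c v = 0.
Proof.
move=> liB AB us sBA /span_uniqP[t [d [ut tA E]]] v vs.
have sA w : w \in s -> w \in A = false.
  by move=> /sBA[_ nAw]; apply/negP; rewrite inE.
pose h w := if w \in A then - d w else c w.
suff : h v = 0 by rewrite /h sA.
apply: (liB (s ++ t)); last by rewrite mem_cat vs.
- rewrite cat_uniq us ut andbT; apply/hasPn => w /tA Aw.
  by apply/negP => /sBA[].
- by move=> w /=; rewrite mem_cat => /orP[/sBA[]|/tA /AB].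
rewrite big_cat /=.
have -> : \sum_(w <- s) h w *: w = \sum_(w <- s) c w *: w.
  by apply: eq_big_seq => w ws; rewrite /h sA.
rewrite E -big_split /= big_seq big1 // => w /tA Aw.
by rewrite /h mem_set // scaleNr subrr.
Qed.

End Span.

(** * Monotonicity of the dimension along injections *)

Section Dimension.
Local Open Scope classical_set_scope.
Local Open Scope card_scope.
Local Open Scope ring_scope.
Context {k : fieldType}.

Lemma basis_of_injective {U Q : lmodType k} (g : {linear U -> Q}) {B : set Q} :
  injective g -> is_basis B -> exists2 E : set U, is_basis E & E #<= B.
Proof.
move=> g_inj [liB /span_generating spB].
have [A [[AB A0] Amax]] : exists A, (A `<=` B /\ forall u, span A (g u) -> u = 0) /\
    forall X, A `<` X -> ~ (X `<=` B /\ forall u, span X (g u) -> u = 0).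
  apply: (Zorn_bigcup (P := [set X | X `<=` B /\ forall u, span X (g u) -> u = 0])).
  move=> F FP tF; split; first by move=> x [X /FP[XB _] /XB].
  (* For the empty chain only [g u = 0] is known, and injectivity of [g] gives [u = 0]. *)
  move=> u /(span_bigcup_total tF)[gu0|[X /FP[_ X0] /X0 //]].
  by apply: g_inj; rewrite gu0 linear0.
have ex b : (B `\` A) b -> exists u, span A (b - g u).
  move=> [Bb nAb]; apply: contrapT => nex.
  (* Without such a [u], adjoining [b] would contradict maximality: if [g u] is [a *: b] modulo
     [span A] with [u] nonzero, then [a] is nonzero by [A0], and [a^-1 *: u] is the excluded
     vector. *)
  apply: (Amax (b |` A)).
    by split=> [x Ax|bA_A]; [right | apply/nAb/bA_A; left].
  split=> [x [->|/AB]|u /span_setU1[a sa]] //; apply: contrapT => u0.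
  have [a0|a0] := eqVneq a 0.
    by apply/u0/A0; move: sa; rewrite a0 scale0r subr0.
  apply: nex; exists (a^-1 *: u); move: (spanN (spanZ a^-1 sa)).
  by rewrite scalerBr scalerA mulVf // scale1r opprB (linearZ_LR g).
pose e b := xget 0 [set u | span A (b - g u)].
have eP b : (B `\` A) b -> span A (b - g (e b)).
  by move=> /ex; exact: (@xgetPex U 0 [set u | span A (b - g u)]).
exists (e @` (B `\` A)); last first.
  by apply: card_le_trans (card_image_le _ _) (subset_card_le _) => b [].
split.
  move=> s c us sE s0 v vs.
  (* [r] picks a preimage under [e], which turns a relation among values of [e] into one among
     elements of [B] outside [A]. *)
  pose r u := xget 0 [set b | (B `\` A) b /\ e b = u].
  have rP u : u \in s -> (B `\` A) (r u) /\ e (r u) = u.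
    move=> /sE [b Cb eb].
    exact: (@xgetI Q 0 [set b | (B `\` A) b /\ e b = u] b).
  have <- : c (e (r v)) = c v by case: (rP v vs) => _ ->.
  apply: (@linearly_independent_mod _ _ A B (map r s) (c \o e)) => //.
  - rewrite map_inj_in_uniq // => x y xs ys rxy.
    by case: (rP x xs) => _ <-; case: (rP y ys) => _ <-; rewrite rxy.
  - by move=> w /= /mapP[u us' ->]; case: (rP u us').
  - rewrite big_map.
    (* Applying [g] to the given relation shows that the subtracted terms sum to 0; each remaining
       [r u - g u] lies in [span A]. *)
    have -> : \sum_(u <- s) (c \o e) (r u) *: r u =
              \sum_(u <- s) c u *: (r u - g u).
      have gs0 : \sum_(u <- s) g (c u *: u) = 0 by rewrite -linear_sum s0 linear0.
      rewrite -[LHS]subr0 -[X in _ - X]gs0 -sumrB.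
      apply: eq_big_seq => u us'.
      by rewrite /= (linearZ_LR g) scalerBr; case: (rP u us') => _ ->.
    by apply: span_sum => u us'; case: (rP u us') => /eP; move=> + eE; rewrite eE.
  - exact: map_f.
apply/span_generating => x.
(* In an expansion of [g x] over [B], terms from [A] are dropped and every other [b] contributes
   [e b] to [z]. Then [g (x - z)] lies in [span A], so [A0] gives [x = z]. *)
have [z sz] : exists2 z, span (e @` (B `\` A)) z & span A (g x - g z).
  elim: (spB (g x)) => [|a b y Bb _ [z sz yz]].
    by exists 0; [|rewrite linear0 subr0]; exact: span0.
  have [Ab|nAb] := pselect (A b).
    by exists z => //; rewrite -addrA; exact: span_cons.
  exists (a *: e b + z); first by apply: span_cons => //; exists b.
  rewrite linearD linearZ opprD addrACA -scalerBr.
  by apply: spanD => //; apply: spanZ; exact: eP.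
by rewrite -linearB => /A0 /eqP; rewrite subr_eq0 => /eqP ->.
Qed.

Lemma dim_lt_injective {U Q : lmodType k} (g : {linear U -> Q})
    {kappa kappa' : Type} :
  injective g -> [set: kappa'] #<= [set: kappa] ->
  dim_lt Q kappa' -> dim_lt U kappa.
Proof.
move=> g_inj le_kappa [B bB [leB ltB]].
have [E bE leEB] := basis_of_injective g g_inj bB.
exists E => //; split.
  exact: card_le_trans leEB (card_le_trans leB le_kappa).
by move=> leE; apply: ltB; exact: card_le_trans le_kappa (card_le_trans leE leEB).
Qed.

End Dimension.

Lemma eq_pi_quotv {k : fieldType} {V : lmodType k} (W : submodClosed V) (x y : V) :
  (\pi_(quotv W)%qT x == \pi_(quotv W)%qT y) = (x - y \in W)%R.
Proof. exact/esym/(@Quotient.idealrBE _ (submod_zmodClosed W)). Qed.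

(** * Preimages of subspaces and the induced map of quotients *)

Section Preimage.
Local Open Scope ring_scope.
Local Open Scope quotient_scope.
Context {k : fieldType} {V V' : lmodType k} (f : {linear V -> V'}).
Variable W' : submodClosed V'.

Definition preim_pred : {pred V} := [pred x | f x \in W'].

Lemma preim_submod_closed : submod_closed preim_pred.
Proof.
split=> [|a x y]; rewrite !inE ?linear0 ?rpred0 // => fx fy.
by rewrite linearP rpredD // rpredZ.
Qed.

Definition preim_submod : submodClosed V :=
  HB.pack preim_pred
    (GRing.isSubmodClosed.Build k V preim_pred preim_submod_closed).

(** This is the map induced by [f]; [preim_quot_map_pi] shows that the chosen representative does
    not matter. *)
Definition preim_quot_map (x : quotv preim_submod) : quotv W' :=
  \pi_(quotv W') (f (repr x)).

Lemma preim_quot_map_pi (x : V) :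
  preim_quot_map (\pi_(quotv preim_submod) x) = \pi_(quotv W') (f x).
Proof.
apply/eqP; rewrite eq_pi_quotv -linearB.
have /eqP : \pi_(quotv preim_submod) (repr (\pi_(quotv preim_submod) x)) =
  \pi_(quotv preim_submod) x by rewrite reprK.
by rewrite eq_pi_quotv.
Qed.

Lemma preim_quot_map_linear : linear preim_quot_map.
Proof.
move=> a x y; rewrite -[x]reprK -[y]reprK; move: (repr x) (repr y) => u v.
rewrite -[a *: _]pi_quotv_scale -raddfD !preim_quot_map_pi linearP raddfD.
by rewrite [X in X + _]pi_quotv_scale.
Qed.

HB.instance Definition _ :=
  GRing.isLinear.Build k _ _ _ preim_quot_map preim_quot_map_linear.

Lemma preim_quot_map_inj : injective preim_quot_map.
Proof.
move=> x y; rewrite -[x]reprK -[y]reprK; move: (repr x) (repr y) => u v.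
rewrite !preim_quot_map_pi => /eqP; rewrite eq_pi_quotv -linearB => fuv.
by apply/eqP; rewrite eq_pi_quotv.
Qed.

End Preimage.

Lemma codim_lt_preim {k : fieldType} {V V' : lmodType k} (f : {linear V -> V'})
    (W' : submodClosed V') {kappa kappa' : Type} :
    ([set: kappa'] #<= [set: kappa])%card ->
  codim_lt W' kappa' -> codim_lt (preim_submod f W') kappa.
Proof.
exact: (dim_lt_injective (preim_quot_map f W') (preim_quot_map_inj f W')).
Qed.

(** * Reduction of continuity to the origin *)

Section Continuity.
Local Open Scope classical_set_scope.
Local Open Scope ring_scope.
Context {k : fieldType}.

Lemma continuous_translation {V : discreteTvsType k} (a : V) :
  continuous (fun x : V => a + x).
Proof.
move=> x; apply: (@continuous_comp V (V * V)%type V (fun x => (a, x))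
  (fun z => z.1 + z.2)); last exact: dtvs_add_continuous.
by apply: cvg_pair => //=; exact: cvg_cst.
Qed.

(** Near [x], [f] is the composite of translation by [- x], [f] near 0, and translation by [f x]. *)
Lemma linear_continuous0 {V V' : discreteTvsType k} (f : {linear V -> V'}) :
  {for 0, continuous f} -> continuous f.
Proof.
move=> f0 x.
have -> : (f : V -> V') = (fun y => f x + y) \o f \o (fun y => - x + y).
  by apply/funext => y /=; rewrite -linearD addrA subrr add0r.
apply: continuous_comp; first exact: continuous_translation.
apply: continuous_comp; last exact: continuous_translation.
by rewrite addNr.
Qed.

End Continuity.

Theorem proposition2p14 (k : fieldType) (kappa kappa' : Type)
  (hkappa : one_or_infinite kappa) (hkappa' : one_or_infinite kappa')
  (V V' : discreteTvsType k)
  (hV : has_codim_topology V kappa) (hV' : has_codim_topology V' kappa') :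
  ([set: kappa'] #<= [set: kappa])%card -> CHom V V' = LHom V V'.
Proof.
move=> le_kappa; apply/seteqP; split=> // f _.
apply: linear_continuous0; rewrite /prop_for /continuous_at linear0 => P.
(* The image under [f] of the neighborhood filter of 0 is a filter, so it only has to contain the
   generators of the filter on [V']. *)
rewrite hV'; apply: (@smallest_sub _ Filter _ (fmap f (nbhs (0%R : V)))).
move=> _ [W' W'codim <-].
rewrite hV; apply: sub_gen_smallest.
by exists (preim_submod f W') => //; exact: (codim_lt_preim f W' le_kappa).
Qed.
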